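(* Let $k\ge2$, $\sigma=\sigma_0\cdots\sigma_{k-1}\in\{+,-\}^k$, and let $n\ge2$ be an integer. Then: (1) if $\sigma_0=\sigma_{k-1}=+$, then $|\mathcal A_n(\Sigma_\sigma)|\le a(n,k)+(k-2)k^{n-2}$; (2) if $\sigma_0\ne\sigma_{k-1}$, then $|\mathcal A_n(\Sigma_\sigma)|\le a(n,k)+(k-1)k^{n-2}$; (3) if $\sigma_0=\sigma_{k-1}=-$, then $|\mathcal A_n(\Sigma_\sigma)|\le a(n,k)+(k^2-2)k^{n-3}$.
   Context: $\mathcal W_k$ is the set of infinite words $s_1s_2\cdots$ over $\{0,\dots,k-1\}$; $T^-_\sigma=\{t:\sigma_t=-\}$. Order $\prec_\sigma$: for $s\ne t$, with $j$ minimal such that $s_j\ne t_j$ and $c=|\{1\le i<j:s_i\in T^-_\sigma\}|$, $s\prec_\sigma t$ iff ($c$ even and $s_j<t_j$) or ($c$ odd and $s_j>t_j$). The signed shift is $\Sigma_\sigma(s_1s_2\cdots)=s_2s_3\cdots$. For distinct elements $x_1,\dots,x_n$ of a linearly ordered set, $\rho(x_1,\dots,x_n)$ is the permutation of $[n]$ with the same relative order. $\mathrm{Pat}(s,\Sigma_\sigma,n)=\rho(s,\Sigma_\sigma(s),\dots,\Sigma_\sigma^{n-1}(s))$ (w.r.t. $\prec_\sigma$) when these words are pairwise distinct, undefined otherwise; $\mathcal A_n(\Sigma_\sigma)$ is the set of all defined such patterns. A finite word $q$ is primitive if it is not of the form $r^m$ with $m>1$ ($r^m$ = concatenation of $m$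 copies of $r$). $\psi_k(t)$ is the number of primitive words of length $t$ over a $k$-letter alphabet, and $a(n,k)=\sum_{t=1}^{n-1}\psi_k(t)\,k^{n-t-1}$. *)

(* Defs.v *)
From mathcomp Require Import all_boot all_order all_algebra all_fingroup.
From mathcomp Require Import boolp.

Set Implicit Arguments.
Unset Strict Implicit.
Unset Printing Implicit Defensive.

Variant sign := Plus | Minus.

(* Infinite words are indexed from 0: the letter s_i is [s (i - 1)]. *)
Definition word (k : nat) := nat -> 'I_k.

Definition in_Tminus (k : nat) (sigma : k.-tuple sign) (t : 'I_k) : bool :=
  if tnth sigma t is Minus then true else false.

Definition prec (k : nat) (sigma : k.-tuple sign) (s t : word k) : Prop :=
  exists j : nat,
    [/\ forall i : nat, i < j -> s i = t i,
        s j != t j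
      & if odd #|[set i : 'I_j | in_Tminus sigma (s i)]|
        then s j > t j else s j < t j].

Definition shift (k : nat) (s : word k) : word k := fun i => s i.+1.

(* [p] is the permutation rho(x_1, ..., x_n); positions and values are shifted
   from {1, ..., n} to 'I_n. *)
Definition same_relative_order (X : Type) (lt : X -> X -> Prop) (n : nat)
    (x : 'I_n -> X) (p : 'S_n) : Prop :=
  forall i j : 'I_n, p i < p j <-> lt (x i) (x j).

Definition orbit_word (k n : nat) (s : word k) (i : 'I_n) : word k :=
  iter i (@shift k) s.

(* Pat(s, Sigma_sigma, n) is defined and equal to [p]. *)
Definition is_Pat (k : nat) (sigma : k.-tuple sign) (n : nat) (s : word k)
    (p : 'S_n) : Prop :=
  injective (@orbit_word k n s) /\
  same_relative_order (prec sigma) (@orbit_word k n s) p.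

Definition allowed (k : nat) (sigma : k.-tuple sign) (n : nat) : {set 'S_n} :=
  [set p : 'S_n | `[< exists s : word k, is_Pat sigma s p >]].

Definition primitive (T : Type) (q : seq T) : Prop :=
  ~ exists (r : seq T) (m : nat), 1 < m /\ q = flatten (nseq m r).

Definition psi (k t : nat) : nat :=
  #|[set q : t.-tuple 'I_k | `[< primitive q >]]|.

Definition a (n k : nat) : nat :=
  \sum_(1 <= t < n) psi k t * k ^ (n - t - 1).

(* Main.v *)
(** Cut a word into its first [N] letters [w] and the rest [y].  Two distinct
    shifts starting inside [w] are compared by their letters in [w] until one
    of them reaches [y], so the pattern of length [N + 1] is determined by [w]
    and by the set of suffixes [q] of [w] with [q y] below [y].  Since [q y]
    and [q^oo] agree up to and including the first letter where [q y] differs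
    from [y], this condition says that [q^oo] is below [y], and [q^oo = r^oo]
    for a primitive suffix [r] of [w].  Enlarging [y] enlarges the set of
    primitive suffixes [r] with [r^oo] below [y], so the size of this set
    determines it, and the sum over [w] of the number of possible sizes is
    [a (N + 1) k + k ^ N].  When the least or the greatest word of the signed
    order is periodic, a prefix [w] ending in its period loses one of the two
    extreme sizes; the period is the end letter itself if its sign is plus, and
    consists of both end letters if both signs are minus. *)
Require Import Defs.
From mathcomp Require Import all_boot all_order all_algebra all_fingroup.
From mathcomp Require Import boolp zify lra.

Set Implicit Arguments.
Unset Strict Implicit.
Unset Printing Implicit Defensive.

Import Order.TTheory GRing.Theory Num.Theory.

Lemma perm_rank n (p : 'S_n) (i : 'I_n) : #|[set j | p j < p i]| = p i.
Proof.
have -> : [set j | p j < p i] = p @^-1: [set v : 'I_n | v < p i].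
  by apply/setP => j; rewrite !inE.
rewrite card_preimset; last exact: perm_inj.
rewrite -sum1_card (eq_bigl (fun v : 'I_n => v < p i)) => [|v]; last first.
  by rewrite inE.
by rewrite (big_ord_narrow (ltnW (ltn_ord (p i)))) sum1_card card_ord.
Qed.

Lemma eq_perm_lt n (p q : 'S_n) :
  (forall i j, p i < p j <-> q i < q j) -> p = q.
Proof.
move=> pq; apply/permP => i; apply: val_inj => /=.
rewrite -(perm_rank p) -(perm_rank q); apply: eq_card => j; rewrite !inE.
by apply/idP/idP => /pq.
Qed.

Lemma card_le_sum_code (T W : finType) (A : {set T}) (h : T -> W)
    (c : T -> nat) (lo up : W -> nat) :
  {in A, forall x, lo (h x) <= c x < up (h x)} ->
  {in A &, forall x y, h x = h y -> c x = c y -> x = y} ->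
  #|A| <= \sum_w (up w - lo w).
Proof.
move=> c_range code_inj.
rewrite -sum1_card (partition_big h xpredT) //=; apply: leq_sum => w _.
rewrite sum1dep_card cardE -(size_map c) -(size_iota (lo w) (up w - lo w)).
apply: uniq_leq_size => [|_ /mapP[x + ->]].
  rewrite map_inj_in_uniq ?enum_uniq // => x y.
  rewrite !mem_enum !inE => /andP[xA /eqP hx] /andP[yA /eqP hy].
  by apply: code_inj => //; rewrite hx hy.
rewrite mem_enum inE mem_iota => /andP[/c_range + /eqP hx].
by rewrite hx; lia.
Qed.

Lemma card_tuple_drop (T : finType) (P : pred (seq T)) i j :
  #|[set w : (i + j).-tuple T | P (drop i w)]| =
  #|[set v : j.-tuple T | P v]| * #|T| ^ i.
Proof.
pose glue (c : i.-tuple T * j.-tuple T) := [tuple of c.1 ++ c.2].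
have glue_inj : injective glue.
  move=> [u v] [u' v'] /(congr1 val)/eqP /=; rewrite eqseq_cat ?size_tuple //.
  by case/andP => /eqP/val_inj -> /eqP/val_inj ->.
rewrite mulnC -card_tuple -cardsT -cardsX -(card_imset _ glue_inj).
apply: eq_card => w; rewrite inE; apply/idP/imsetP => [Pw|[[u v]]]; last first.
  by rewrite !inE => Pv -> /=; rewrite drop_size_cat ?size_tuple.
have size_take_w : size (take i w) == i.
  by rewrite size_takel // size_tuple leq_addr.
have size_drop_w : size (drop i w) == j by rewrite size_drop size_tuple addKn.
exists (Tuple size_take_w, Tuple size_drop_w); first by rewrite !inE.
by apply: val_inj; rewrite /= cat_take_drop.
Qed.

Section Agreement.

Variable T : Type.
Implicit Types s t u : nat -> T.

Definition agree d s t := forall i, i < d -> s i = t i.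

Lemma agreeW d e s t : d <= e -> agree e s t -> agree d s t.
Proof. by move=> le_de st i lt_id; apply: st; apply: leq_trans le_de. Qed.

Lemma agree_sym d s t : agree d s t -> agree d t s.
Proof. by move=> st i /st. Qed.

Lemma agree_trans d s t u : agree d s t -> agree d t u -> agree d s u.
Proof. by move=> st tu i lt_id; rewrite st // tu. Qed.


End Agreement.

Lemma first_diff (T : eqType) (s t : nat -> T) :
  s <> t -> exists2 d, agree d s t & s d != t d.
Proof.
move=> neq_st; have ex_diff : exists d, s d != t d.
  apply: contrapT => no_diff; apply: neq_st; apply/funext => i; apply/eqP.
  by apply: contrapT => /negP ?; apply: no_diff; exists i.
case: (ex_minnP ex_diff) => d neq_d d_min; exists d => // i lt_id.
by apply/eqP; apply: contraTT lt_id => /d_min; rewrite -leqNgt.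
Qed.

Definition flip_lt (b : bool) (m n : nat) := if b then n < m else m < n.

Lemma flip_ltN b m n : flip_lt (~~ b) m n = flip_lt b n m.
Proof. by case: b. Qed.

Lemma flip_lt_irr b n : flip_lt b n n = false.
Proof. by case: b; rewrite /= ltnn. Qed.

Lemma flip_lt_total b m n : m != n -> flip_lt b m n || flip_lt b n m.
Proof. by rewrite neq_ltn; case: b; rewrite // orbC. Qed.

Lemma flip_lt_trans b : transitive (flip_lt b).
Proof. by move=> n m p; case: b => /= mn np; lia. Qed.

Section SignedOrder.

Variables (k : nat) (sigma : k.-tuple sign).
Implicit Types (s t u x y : word k) (i j d : nat).

Lemma iter_shiftE s m i : iter m (@shift k) s i = s (m + i).
Proof. by elim: m i => //= m IH i; rewrite /shift IH addnS. Qed.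

Definition parity s j := odd #|[set i : 'I_j | in_Tminus sigma (s i)]|.

Lemma parity_sum s j : parity s j = odd (\sum_(i < j) in_Tminus sigma (s i)).
Proof.
rewrite /parity -sum1_card big_mkcond /=; congr odd.
by apply: eq_bigr => i _; rewrite inE; case: in_Tminus.
Qed.

Lemma parityS s j :
  parity s j.+1 = in_Tminus sigma (s 0) (+) parity (shift s) j.
Proof. by rewrite !parity_sum big_ord_recl oddD; case: in_Tminus. Qed.

Lemma eq_parity s t j : agree j s t -> parity s j = parity t j.
Proof.
by move=> st; rewrite !parity_sum; congr odd; apply: eq_bigr => i _; rewrite st.
Qed.

Lemma parity_const s c j :
  (forall i, in_Tminus sigma (s i) = c) -> parity s j = c && odd j.
Proof.
move=> sign_s; rewrite parity_sum (eq_bigr (fun=> nat_of_bool c)) => [|i _].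
  by rewrite sum_nat_const card_ord oddM oddb andbC.
by rewrite sign_s.
Qed.

Lemma precP s t : prec sigma s t <->
  exists2 d, agree d s t & flip_lt (parity s d) (s d) (t d).
Proof.
split=> [[d [st _ lt_st]]|[d st lt_st]]; first by exists d.
exists d; split=> //; apply/eqP => eq_d.
by move: lt_st; rewrite eq_d flip_lt_irr.
Qed.

Lemma prec_first_diffP s t d : agree d s t -> s d != t d ->
  reflect (prec sigma s t) (flip_lt (parity s d) (s d) (t d)).
Proof.
move=> st neq_d; apply: (iffP idP) => [lt_st|/precP[e st' lt_st]].
  by apply/precP; exists d.
case: (ltngtP d e) => [/st' eq_d|/st eq_e|-> //].
  by rewrite eq_d eqxx in neq_d.
by rewrite eq_e flip_lt_irr in lt_st.
Qed.

Lemma prec_total s t : s <> t -> prec sigma s t \/ prec sigma t s.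
Proof.
case/first_diff => d st neq_d; have neq_d' : t d != s d by rewrite eq_sym.
case/orP: (flip_lt_total (parity s d) neq_d) => [lt_st|lt_ts]; [left|right].
  exact/(prec_first_diffP st neq_d).
by apply/(prec_first_diffP (agree_sym st) neq_d'); rewrite -(eq_parity st).
Qed.

Lemma prec_irrefl s : ~ prec sigma s s.
Proof. by case/precP => d _; rewrite flip_lt_irr. Qed.

Lemma prec_trans s t u : prec sigma s t -> prec sigma t u -> prec sigma s u.
Proof.
move=> /precP[d st lt_st] /precP[e tu lt_tu]; apply/precP.
case: (ltngtP d e) => [lt_de|lt_ed|eq_de].
- exists d; last by rewrite -tu.
  exact: agree_trans st (agreeW (ltnW lt_de) tu).
- have st_e := agreeW (ltnW lt_ed) st.
  by exists e; [exact: agree_trans tu | rewrite (eq_parity st_e) st].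
rewrite -{e}eq_de in tu lt_tu; exists d; first exact: agree_trans tu.
by apply: flip_lt_trans lt_st _; rewrite (eq_parity st).
Qed.

Lemma prec_asym s t : prec sigma s t -> ~ prec sigma t s.
Proof. by move=> st ts; apply: prec_irrefl (prec_trans st ts). Qed.

Lemma prec_headP s t : s 0 != t 0 -> reflect (prec sigma s t) (s 0 < t 0).
Proof.
move=> neq0; have -> : (s 0 < t 0) = flip_lt (parity s 0) (s 0) (t 0).
  by rewrite parity_sum big_ord0.
exact: prec_first_diffP.
Qed.

Lemma prec_shift s t : s 0 = t 0 ->
  prec sigma s t <->
  if in_Tminus sigma (s 0) then prec sigma (shift t) (shift s)
  else prec sigma (shift s) (shift t).
Proof.
move=> eq0; have [->|] := pselect (s = t).
  by split=> [/prec_irrefl //|]; case: ifP => _ /prec_irrefl.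
case/first_diff => -[|d] st neq_d; first by rewrite eq0 eqxx in neq_d.
have sh_st : agree d (shift s) (shift t) by move=> i; exact: st i.+1.
have neq_d' : shift t d != shift s d by rewrite eq_sym.
have ltP := prec_first_diffP st neq_d; rewrite parityS in ltP.
rewrite (rwP ltP); case: in_Tminus => /=.
  rewrite (rwP (prec_first_diffP (agree_sym sh_st) neq_d')).
  by rewrite flip_ltN (eq_parity sh_st).
by rewrite (rwP (prec_first_diffP sh_st neq_d)).
Qed.

Section ReplaceLeft.

Variables x x' y : word k.
Hypothesis agree_xx' : forall d, agree d x y -> agree d.+1 x x'.

Lemma neq_replacel : x <> y -> x' <> y.
Proof.
case/first_diff => d xy neq_d eq_x'y.
by rewrite (agree_xx' xy) // eq_x'y eqxx in neq_d.
Qed.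

Lemma prec_replacel : prec sigma x y <-> prec sigma x' y.
Proof.
have [eq_xy|] := pselect (x = y).
  suff -> : x' = x by [].
  by apply/funext => i; rewrite (@agree_xx' i) // eq_xy.
case/first_diff => d xy neq_d; have xx' := agree_xx' xy.
have x'y : agree d x' y.
  exact: agree_trans (agree_sym (agreeW (leqnSn d) xx')) xy.
have neq_d' : x' d != y d by rewrite -xx'.
rewrite (rwP (prec_first_diffP xy neq_d)) (rwP (prec_first_diffP x'y neq_d')).
by rewrite xx' // (eq_parity (agreeW (leqnSn d) xx')).
Qed.

End ReplaceLeft.

(* Dropping a common first letter preserves or reverses the order, so descending
   induction reduces any comparison to one with the last shift. *)
Lemma prec_iter_shift s t N :
  agree N s t ->
  (forall i, i < N -> iter i (@shift k) t <> iter N (@shift k) t) ->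
  (forall i, i < N -> prec sigma (iter i (@shift k) s) (iter N (@shift k) s) <->
                      prec sigma (iter i (@shift k) t) (iter N (@shift k) t)) ->
  forall i j, i <= N -> j <= N ->
  prec sigma (iter i (@shift k) s) (iter j (@shift k) s) ->
  prec sigma (iter i (@shift k) t) (iter j (@shift k) t).
Proof.
move=> st neq_t eq_last i j.
have head_st l : l < N -> iter l (@shift k) s 0 = iter l (@shift k) t 0.
  by move=> lt_lN; rewrite !iter_shiftE !addn0 st.
have [n] := ubnP (N - maxn i j); elim: n i j => // n IH i j.
rewrite ltnS => le_n; case: (ltngtP i N) => // [lt_iN|->] _;
  case: (ltngtP j N) => // [lt_jN|->] _.
- have [eq0|neq0] := eqVneq (iter i (@shift k) s 0) (iter j (@shift k) s 0).
    move/(prec_shift eq0) => lt_sh; apply/prec_shift.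
      by rewrite -!head_st.
    rewrite -head_st //; move: lt_sh.
    by case: in_Tminus; apply: (IH _.+1 _.+1) => //; lia.
  move/(prec_headP neq0); rewrite !head_st // in neq0 * => lt0.
  exact/(prec_headP neq0).
- by move/(eq_last i lt_iN).
- move/prec_asym => not_lt.
  by case: (prec_total (neq_t j lt_jN)) => // /(eq_last j lt_jN) /not_lt.
- by move/prec_irrefl.
Qed.

End SignedOrder.

Section PeriodicWords.

Variables (T : Type) (x0 : T).
Implicit Types q r : seq T.

Definition periodic_word q : nat -> T := fun j => nth x0 q (j %% size q).

Lemma periodic_wordDl q j : periodic_word q (size q + j) = periodic_word q j.
Proof. by rewrite /periodic_word modnDl. Qed.

Lemma agree_periodic (x : nat -> T) m d : 0 < m ->
  agree d x (fun j => x (m + j)) -> agree (m + d) x (periodic_word (mkseq x m)).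
Proof.
move=> m_gt0 xm i; have [n] := ubnP i; elim: n i => // n IH i.
rewrite ltnS => le_in lt_i; have [lt_im|le_mi] := ltnP i m.
  by rewrite /periodic_word size_mkseq modn_small ?nth_mkseq.
rewrite -(subnKC le_mi) -xm; last by lia.
by rewrite -[X in X + (i - m)](size_mkseq x) periodic_wordDl IH //; lia.
Qed.

Lemma size_flatten_nseq m r : size (flatten (nseq m r)) = m * size r.
Proof. by elim: m => //= m IH; rewrite size_cat IH mulSn. Qed.

Lemma nth_flatten_nseq m r j : j < m * size r ->
  nth x0 (flatten (nseq m r)) j = nth x0 r (j %% size r).
Proof.
elim: m j => [|m IH] j //=; rewrite mulSn => lt_j.
rewrite nth_cat; case: ltnP => [lt_jr|le_rj]; first by rewrite modn_small.
by rewrite IH ?ltn_subLR // -[in RHS](subnK le_rj) modnDr.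
Qed.

Lemma periodic_word_flatten m r : 0 < m -> 0 < size r ->
  periodic_word (flatten (nseq m r)) = periodic_word r.
Proof.
move=> m_gt0 r_gt0; apply/funext => j; rewrite /periodic_word size_flatten_nseq.
by rewrite nth_flatten_nseq ?ltn_mod ?muln_gt0 ?m_gt0 // modn_dvdm // dvdn_mull.
Qed.

Lemma primitive_suffix q : 0 < size q ->
  exists d, [/\ d < size q, primitive (drop d q)
              & periodic_word (drop d q) = periodic_word q].
Proof.
have [n] := ubnP (size q); elim: n q => // n IH q; rewrite ltnS => le_qn q_gt0.
case: (pselect (primitive q)) => [|/contrapT[r [[|[|m]] [// _ def_q]]]].
  by exists 0; rewrite drop0.
have size_q : size q = m.+2 * size r by rewrite def_q size_flatten_nseq.
have r_gt0 : 0 < size r by move: q_gt0; rewrite size_q muln_gt0.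
have [||d [lt_dr prim_d eq_d]] := IH r => //; first by nia.
exists (m.+1 * size r + d).
have -> : drop (m.+1 * size r + d) q = drop d r.
  rewrite addnC -drop_drop def_q -[m.+2]addn1 nseqD flatten_cat.
  by rewrite drop_size_cat ?size_flatten_nseq //= cats0.
by split; rewrite ?eq_d ?def_q ?periodic_word_flatten // size_flatten_nseq; lia.
Qed.

End PeriodicWords.

Section ExtremeWords.

Variables (k : nat) (sigma : k.+1.-tuple sign).
Implicit Types (s : word k.+1) (b : bool).

(* [b = false] stands for the least word or letter, [b = true] for the
   greatest one. *)
Definition extreme b s :=
  forall t, ~ if b then prec sigma s t else prec sigma t s.

Definition end_letter b : 'I_k.+1 := if b then ord_max else ord0.

Lemma extreme_letters b s :
  (forall j, s j = end_letter (b (+) parity sigma s j)) -> extreme b s.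
Proof.
move=> s_end t; case: b s_end => s_end /precP[d eq_d].
  rewrite s_end; case: parity => //=; first by have := ltn_ord (t d); lia.
rewrite s_end (eq_parity sigma eq_d); case: parity => //=.
by have := ltn_ord (t d); lia.
Qed.

Lemma extreme_constant b : in_Tminus sigma (end_letter b) = false ->
  extreme b (periodic_word ord0 [:: end_letter b]).
Proof.
move=> sign_b; set s := periodic_word _ _.
have const i : s i = end_letter b by rewrite /s /periodic_word modn1.
have sign_const i : in_Tminus sigma (s i) = false by rewrite const.
by apply: extreme_letters => j; rewrite (parity_const j sign_const) addbF.
Qed.

Lemma extreme_alternating b : (forall c, in_Tminus sigma (end_letter c)) ->
  extreme b (periodic_word ord0 [:: end_letter b; end_letter (~~ b)]).
Proof.
move=> sign_minus; set s := periodic_word _ _.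
have alt i : s i = end_letter (b (+) odd i).
  by rewrite /s /periodic_word modn2; case: odd; rewrite ?addbT ?addbF.
have sign_alt i : in_Tminus sigma (s i) = true by rewrite alt sign_minus.
by apply: extreme_letters => j; rewrite (parity_const j sign_alt) alt.
Qed.

End ExtremeWords.

Section PatternCode.

Variables (k : nat) (sigma : k.+1.-tuple sign) (N : nat).
Implicit Types (s t y z : word k.+1) (w : N.-tuple 'I_k.+1) (b : bool).

Definition head_word s : N.-tuple 'I_k.+1 := [tuple s i | i < N].
Definition tail_word s : word k.+1 := iter N (@shift k.+1) s.

Definition prim_suffixes w : {set 'I_N} :=
  [set i : 'I_N | `[< primitive (drop i w) >]].

Definition breakpoint w i : word k.+1 := periodic_word ord0 (drop i w).

Definition breakpoints_below w y : {set 'I_N} :=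
  [set i in prim_suffixes w | `[< prec sigma (breakpoint w i) y >]].

Lemma breakpoint_primitive w (i : 'I_N) :
  exists2 j, j \in prim_suffixes w & breakpoint w j = breakpoint w i.
Proof.
have [|d [lt_d prim_d eq_d]] := @primitive_suffix _ ord0 (drop i w).
  by rewrite size_drop size_tuple subn_gt0.
rewrite size_drop size_tuple in lt_d; have lt_diN : d + i < N by lia.
rewrite drop_drop in prim_d eq_d.
by exists (Ordinal lt_diN); first by rewrite inE; apply/asboolP.
Qed.

Lemma prim_suffixes_gt0 w : 0 < N -> 0 < #|prim_suffixes w|.
Proof.
move=> N_gt0; have [j prim_j _] := breakpoint_primitive w (Ordinal N_gt0).
by apply/card_gt0P; exists j.
Qed.

Lemma breakpoints_below_sub w y : breakpoints_below w y \subset prim_suffixes w.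
Proof. by apply/subsetP => i; rewrite inE => /andP[]. Qed.

Lemma breakpoints_below_homo w y z :
  prec sigma y z -> breakpoints_below w y \subset breakpoints_below w z.
Proof.
move=> lt_yz; apply/subsetP => i; rewrite !inE => /andP[-> /asboolP lt_iy] /=.
by apply/asboolP; apply: prec_trans lt_yz.
Qed.

Lemma card_breakpoints_below_inj w y z :
  #|breakpoints_below w y| = #|breakpoints_below w z| ->
  breakpoints_below w y = breakpoints_below w z.
Proof.
move=> eq_card_yz; have [->//|neq_yz] := pselect (y = z).
case: (prec_total sigma neq_yz) => /(breakpoints_below_homo w) sub.
  by apply/eqP; rewrite eqEcard sub eq_card_yz /=.
by apply/esym/eqP; rewrite eqEcard sub eq_card_yz /=.
Qed.

Lemma prec_breakpoint_eq w y z (i : 'I_N) :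
  breakpoints_below w y = breakpoints_below w z ->
  prec sigma (breakpoint w i) y <-> prec sigma (breakpoint w i) z.
Proof.
move=> /setP eq_below; have [j prim_j <-] := breakpoint_primitive w i.
have := eq_below j; rewrite !inE; move: prim_j; rewrite inE => -> /=.
exact: asbool_eq_equiv.
Qed.

Lemma breakpoint_head_word s (i : 'I_N) :
  breakpoint (head_word s) i =
    periodic_word ord0 (mkseq (iter i (@shift k.+1) s) (N - i)).
Proof.
congr periodic_word; apply: (@eq_from_nth _ ord0) => [|j].
  by rewrite size_drop size_tuple size_mkseq.
rewrite size_drop size_tuple => lt_j; have lt_ijN : i + j < N by lia.
rewrite nth_drop nth_mkseq // iter_shiftE.
by rewrite (nth_map (Ordinal lt_ijN)) ?size_enum_ord // nth_enum_ord.
Qed.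

Lemma agree_breakpoint s (i : 'I_N) d :
  agree d (iter i (@shift k.+1) s) (tail_word s) ->
  agree d.+1 (iter i (@shift k.+1) s) (breakpoint (head_word s) i).
Proof.
have lt_iN := ltn_ord i; rewrite breakpoint_head_word => s_tail.
apply: (@agreeW _ _ (N - i + d)); first by lia.
apply: agree_periodic => [|j /s_tail ->]; first by lia.
by rewrite /tail_word !iter_shiftE addnA subnKC // ltnW.
Qed.

Lemma prec_tail_breakpoint s (i : 'I_N) :
  prec sigma (iter i (@shift k.+1) s) (tail_word s) <->
  prec sigma (breakpoint (head_word s) i) (tail_word s).
Proof. by apply: prec_replacel => d; apply: agree_breakpoint. Qed.

Lemma orbit_neq_tail s (i : 'I_N) : injective (@orbit_word k.+1 N.+1 s) ->
  iter i (@shift k.+1) s <> tail_word s.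
Proof.
move=> inj_s /(inj_s (widen_ord (leqnSn N) i) ord_max)/(congr1 val) => /= eq_iN.
by have := ltn_ord i; rewrite eq_iN ltnn.
Qed.

Lemma agree_head_word s t : head_word s = head_word t -> agree N s t.
Proof.
move=> eq_head i lt_iN.
have := congr1 (fun w => tnth w (Ordinal lt_iN)) eq_head.
by rewrite !tnth_mktuple.
Qed.

Lemma prec_orbit s t :
  injective (@orbit_word k.+1 N.+1 t) -> head_word s = head_word t ->
  breakpoints_below (head_word s) (tail_word s) =
    breakpoints_below (head_word t) (tail_word t) ->
  forall i j : 'I_N.+1,
  prec sigma (orbit_word s i) (orbit_word s j) ->
  prec sigma (orbit_word t i) (orbit_word t j).
Proof.
move=> inj_t eq_head eq_below i j.
apply: prec_iter_shift (leq_ord i) (leq_ord j); first exact: agree_head_word.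
  by move=> l lt_l; exact: (orbit_neq_tail (i := Ordinal lt_l)).
move=> l lt_l; rewrite -!/(tail_word _).
rewrite (prec_tail_breakpoint s (Ordinal lt_l)).
rewrite (prec_tail_breakpoint t (Ordinal lt_l)) -eq_head.
by apply: prec_breakpoint_eq; rewrite eq_below -eq_head.
Qed.

Lemma pattern_code_inj s t (p q : 'S_N.+1) :
  is_Pat sigma s p -> is_Pat sigma t q -> head_word s = head_word t ->
  #|breakpoints_below (head_word s) (tail_word s)| =
    #|breakpoints_below (head_word t) (tail_word t)| ->
  p = q.
Proof.
move=> [inj_s ord_p] [inj_t ord_q] eq_head eq_card_below.
have eq_below : breakpoints_below (head_word s) (tail_word s) =
    breakpoints_below (head_word t) (tail_word t).
  by move: eq_card_below; rewrite -eq_head => /card_breakpoints_below_inj.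
apply: eq_perm_lt => i j; split=> [/ord_p|/ord_q] lt_ij.
  exact/ord_q/(prec_orbit inj_t eq_head eq_below).
exact/ord_p/(prec_orbit inj_s (esym eq_head) (esym eq_below)).
Qed.

Definition extreme_heads b : {set N.-tuple 'I_k.+1} :=
  [set w | `[< exists i : 'I_N, extreme sigma b (breakpoint w i) >]].

Lemma extreme_headsP b w : w \in extreme_heads b ->
  exists2 i, i \in prim_suffixes w & extreme sigma b (breakpoint w i).
Proof.
rewrite inE => /asboolP[i ext_i].
by have [j prim_j eq_ji] := breakpoint_primitive w i; exists j; rewrite ?eq_ji.
Qed.

Lemma breakpoints_below_range s (w := head_word s) :
  injective (@orbit_word k.+1 N.+1 s) ->
  (w \in extreme_heads false) <= #|breakpoints_below w (tail_word s)|
    < #|prim_suffixes w|.+1 - (w \in extreme_heads true).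
Proof.
move=> inj_s; apply/andP; split.
  case: (boolP (_ \in _)) => // /extreme_headsP[i prim_i least_i].
  apply/card_gt0P; exists i; rewrite inE prim_i; apply/asboolP.
  have neq_i : breakpoint w i <> tail_word s.
    by apply: neq_replacel (orbit_neq_tail inj_s) => d; apply: agree_breakpoint.
  by case: (prec_total sigma neq_i) => // /least_i.
case: (boolP (_ \in _)) => [/extreme_headsP[i prim_i greatest_i]|_]; last first.
  by rewrite subn0 ltnS subset_leq_card ?breakpoints_below_sub.
rewrite subn1; apply/proper_card/properP.
split; first exact: breakpoints_below_sub.
by exists i; rewrite // inE prim_i /=; apply/asboolP; apply: greatest_i.
Qed.

Lemma allowed_realizers : exists f : 'S_N.+1 -> word k.+1,
  {in allowed sigma N.+1, forall p, is_Pat sigma (f p) p}.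
Proof.
have /choice[f f_pat] (p : 'S_N.+1) : exists s,
    p \in allowed sigma N.+1 -> is_Pat sigma s p.
  have [|_] := boolP (p \in _); last by exists (fun=> ord0).
  by rewrite inE => /asboolP[s]; exists s.
by exists f => p; apply: f_pat.
Qed.

Lemma card_allowed_le_codes :
  #|allowed sigma N.+1| <= \sum_(w : N.-tuple 'I_k.+1)
    (#|prim_suffixes w|.+1 - (w \in extreme_heads true)
       - (w \in extreme_heads false)).
Proof.
have [f f_pat] := allowed_realizers.
apply: (card_le_sum_code (h := fun p => head_word (f p))
  (c := fun p => #|breakpoints_below (head_word (f p)) (tail_word (f p))|)
  (lo := fun w => w \in extreme_heads false)
  (up := fun w => #|prim_suffixes w|.+1 - (w \in extreme_heads true))).
  by move=> p /f_pat[inj_fp _]; apply: breakpoints_below_range.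
by move=> p q /f_pat fp /f_pat fq; apply: pattern_code_inj.
Qed.

Lemma sum_prim_suffixes :
  \sum_(w : N.-tuple 'I_k.+1) #|prim_suffixes w| = a N.+1 k.+1.
Proof.
under eq_bigr do rewrite -sum1_card big_mkcond.
rewrite exchange_big /a big_add1 /= big_mkord (reindex_inj rev_ord_inj) /=.
apply: eq_bigr => i _; rewrite -big_mkcond sum1dep_card /=.
have -> : N.+1 - i.+1 - 1 = N - i.+1 by lia.
pose prim (q : seq 'I_k.+1) := `[< primitive q >].
have := card_tuple_drop prim (N - i.+1) i.+1; rewrite subnK //.
by rewrite card_ord => <-; apply: eq_card => w; rewrite !inE.
Qed.

Lemma card_allowed_le : 0 < N ->
  #|allowed sigma N.+1| + (#|extreme_heads false| + #|extreme_heads true|) <=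
    a N.+1 k.+1 + k.+1 ^ N.
Proof.
move=> N_gt0.
have card_sum (A : {set N.-tuple 'I_k.+1}) : #|A| = \sum_w (w \in A).
  by rewrite -sum1_card big_mkcond.
have card_words : k.+1 ^ N = \sum_(w : N.-tuple 'I_k.+1) 1.
  by rewrite sum1_card card_tuple card_ord.
apply: leq_trans (leq_add card_allowed_le_codes (leqnn _)) _.
rewrite -sum_prim_suffixes card_words !card_sum -!big_split /=.
apply: leq_sum => w _; have := prim_suffixes_gt0 w N_gt0.
by case: (_ \in _); case: (_ \in _) => /=; lia.
Qed.

Lemma expn_le_a : 0 < N -> k.+1 ^ N <= a N.+1 k.+1.
Proof.
move=> N_gt0; rewrite -sum_prim_suffixes -[X in X ^ _](card_ord k.+1).
rewrite -card_tuple -sum1_card.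
by apply: leq_sum => w _; apply: prim_suffixes_gt0.
Qed.

End PatternCode.

Lemma in_Tminus_nth k (sigma : k.-tuple sign) (t : 'I_k) :
  in_Tminus sigma t = if nth Plus sigma t is Minus then true else false.
Proof. by rewrite /in_Tminus (tnth_nth Plus). Qed.

Section ExtremeHeads.

Variables (k : nat) (sigma : k.+1.-tuple sign) (b : bool).

Lemma card_extreme_heads m l (v : l.+1.-tuple 'I_k.+1) :
  extreme sigma b (periodic_word ord0 v) ->
  k.+1 ^ m <= #|extreme_heads sigma (m + l.+1) b|.
Proof.
move=> ext_v; have := card_tuple_drop (pred1 (val v)) m l.+1.
have -> : [set u : l.+1.-tuple 'I_k.+1 | pred1 (val v) u] = [set v].
  by apply/setP => u; rewrite !inE.
rewrite cards1 mul1n card_ord => <-; apply/subset_leq_card/subsetP => w.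
rewrite !inE => /eqP drop_w; have lt_m : m < m + l.+1 by lia.
by apply/asboolP; exists (Ordinal lt_m); rewrite /breakpoint /= drop_w.
Qed.

Lemma card_extreme_heads_plus m : nth Plus sigma (end_letter k b) = Plus ->
  k.+1 ^ m <= #|extreme_heads sigma m.+1 b|.
Proof.
move=> plus_b; rewrite -[m.+1]addn1.
apply: (@card_extreme_heads _ _ [tuple end_letter k b]).
by apply: extreme_constant; rewrite in_Tminus_nth plus_b.
Qed.

Lemma card_extreme_heads_minus m :
  (forall c, nth Plus sigma (end_letter k c) = Minus) ->
  k.+1 ^ m <= #|extreme_heads sigma m.+2 b|.
Proof.
move=> minus_ends; rewrite -addn2.
apply: (@card_extreme_heads _ _ [tuple end_letter k b; end_letter k (~~ b)]).
by apply: extreme_alternating => c; rewrite in_Tminus_nth minus_ends.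
Qed.

End ExtremeHeads.

Lemma card_allowed_le_minus_ends k (sigma : k.+2.-tuple sign) m :
  (forall c, nth Plus sigma (end_letter k.+1 c) = Minus) ->
  ((#|allowed sigma m.+2|)%:R <= (a m.+2 k.+2)%:R +
     (k.+2%:R ^+ 2 - 2) * k.+2%:R ^ (m.+2%:Z - 3) :> rat)%R.
Proof.
move=> minus_ends; case: m => [|m].
  have le_a : #|allowed sigma 2| <= a 2 k.+2.
    apply: leq_trans (expn_le_a k.+1 (ltn0Sn 0)).
    by apply: leq_trans (max_card _) _; rewrite card_Sn.
  apply: (@le_trans _ _ (a 2 k.+2)%:R%R); first by rewrite ler_nat.
  by rewrite lerDl mulr_ge0 ?exprz_ge0 ?ler0n // subr_ge0 -natrX ler_nat; nia.
have := card_allowed_le sigma (ltn0Sn m.+1).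
have := card_extreme_heads_minus false m minus_ends.
have := card_extreme_heads_minus true m minus_ends.
have -> : (m.+3%:Z - 3 = m)%R by lia.
move=> le_greatest le_least le_all.
have : #|allowed sigma m.+3| + (k.+2 ^ m + k.+2 ^ m) <=
    a m.+3 k.+2 + k.+2 ^ (m + 2) by rewrite addn2; lia.
by rewrite -(ler_nat rat) -exprnP !natrD !natrX exprD; lra.
Qed.

Theorem theorem3p1 (k : nat) (hk : (2 <= k)%N) (sigma : k.-tuple sign)
    (n : nat) (hn : (2 <= n)%N) :
  [/\ (nth Plus sigma 0 = Plus -> nth Plus sigma (k - 1) = Plus ->
        (#|allowed sigma n| <= a n k + (k - 2) * k ^ (n - 2))%N),
      (nth Plus sigma 0 <> nth Plus sigma (k - 1) ->
        (#|allowed sigma n| <= a n k + (k - 1) * k ^ (n - 2))%N)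
    & (nth Plus sigma 0 = Minus -> nth Plus sigma (k - 1) = Minus ->
        ((#|allowed sigma n|)%:R <=
          (a n k)%:R + (k%:R ^+ 2 - 2) * k%:R ^ (n%:Z - 3) :> rat)%R)].
Proof.
case: k hk sigma => [|[|k]] // _ sigma; case: n hn => [|[|m]] // _.
rewrite subn1 !subSS !subn0.
have bound := card_allowed_le sigma (ltn0Sn m); rewrite expnS !mulSn in bound.
have card_least := @card_extreme_heads_plus _ sigma false m.
have card_greatest := @card_extreme_heads_plus _ sigma true m.
split=> [/card_least le_least /card_greatest le_greatest|neq_ends|? ?].
- lia.
- have [/card_least|/card_greatest] :
    nth Plus sigma 0 = Plus \/ nth Plus sigma k.+1 = Plus; try lia.
  by move: neq_ends; do 2!case: nth; auto.
- by apply: card_allowed_le_minus_ends => -[].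
Qed.
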